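(* Let $\mathcal C\subset\mathbb R^n$ be nonempty, compact and convex; let $f:\mathbb R^n\to\mathbb R$ be continuously differentiable on an open set containing $\mathcal C$ with $\nabla f$ Lipschitz-continuous on $\mathcal C$; let $T:\mathbb R^n\to\mathbb R^m$ be linear; and let $g:\mathbb R^m\to\mathbb R$ be $L_g$-Lipschitz on $\mathbb R^m$ and $\rho$-weakly convex for some $\rho\ge0$. Suppose $(u_j)_j\subset\mathcal C$ and $(\alpha_j)_j\subset\,]0,\rho^{-1}[$ satisfy $\alpha_j\to0$, $u_j\to\bar u$, and $\mathrm{gap}^{\alpha_j}(u_j)\to0$. Then there exists $\bar\xi\in\partial g(T\bar u)$ such that $\mathrm{gap}(\bar u;\bar\xi)=0$, and thus $$0\in\nabla f(\bar u)+T^*\bar\xi+N_{\mathcal C}(\bar u),\quad\text{i.e.,}\quad 0\in\nabla f(\bar u)+T^*\partial g(T\bar u)+N_{\mathcal C}(\bar u).$$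
   Context: Conventions: $\rho^{-1}=+\infty$ if $\rho=0$. $\rho$-weakly convex means $g+\frac{\rho}{2}\|\cdot\|_2^2$ is convex. $\partial g$ is the Clarke subdifferential. $N_{\mathcal C}(x)=\{v:\langle v,s-x\rangle\le0\ \forall s\in\mathcal C\}$ for $x\in\mathcal C$. For $\beta\in\,]0,\rho^{-1}[$, $g^\beta(y)=\min_u\{g(u)+\frac1{2\beta}\|u-y\|_2^2\}$ is the Moreau envelope; it is continuously differentiable with $\nabla g^\beta(y)=\beta^{-1}(y-\mathrm{prox}_{\beta g}(y))$, where $\mathrm{prox}_{\beta g}(y)$ is the unique minimizer. Smoothed Frank-Wolfe gap: for $x\in\mathcal C$, $\mathrm{gap}^\beta(x):=\max_{s\in\mathcal C}\langle\nabla f(x)+T^*\nabla g^\beta(Tx),x-s\rangle$. Nonsmooth Frank-Wolfe subgradient gap: for $\xi\in\partial g(Tx)$, $\mathrm{gap}(x;\xi):=\max_{s\in\mathcal C}\langle\nabla f(x)+T^*\xi,x-s\rangle$. *)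

(* Defs.v *)
From HB Require Import structures.
From mathcomp Require Import all_boot all_order all_algebra.
From mathcomp Require Import all_classical all_reals all_analysis.

Set Implicit Arguments.
Unset Strict Implicit.
Unset Printing Implicit Defensive.

Import Order.TTheory GRing.Theory Num.Theory.
Import numFieldNormedType.Exports.

Local Open Scope classical_set_scope.
Local Open Scope ring_scope.

Section Euclidean.
Context {R : realType}.

Definition dot n (u v : 'rV[R]_n) : R := \sum_(i < n) u ord0 i * v ord0 i.

(* The library norm `|u| on 'rV[R]_n is the sup norm (same topology), hence
   a separate Euclidean norm for the metric hypotheses. *)
Definition norm2 n (u : 'rV[R]_n) : R := Num.sqrt (dot u u).

(* Meaningful where [differentiable f x] holds: then
   'd f x h = dot (grad f x) h for all h. *)
Definition grad n (f : 'rV[R]_n -> R) (x : 'rV[R]_n) : 'rV[R]_n :=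
  \row_(i < n) 'd f x (delta_mx ord0 i).

(* Vectors are rows, so T x = x *m lin1_mx T; see [dot_adjoint]. *)
Definition adjoint n m (T : {linear 'rV[R]_n -> 'rV[R]_m}) (y : 'rV[R]_m) :
    'rV[R]_n :=
  y *m (lin1_mx T)^T.

Lemma dot_mulmx n (u v : 'rV[R]_n) : dot u v = (u *m v^T) ord0 ord0.
Proof. by rewrite mxE; apply: eq_bigr => i _; rewrite mxE. Qed.

Lemma dot_adjoint n m (T : {linear 'rV[R]_n -> 'rV[R]_m}) x y :
  dot (T x) y = dot x (adjoint T y).
Proof. by rewrite !dot_mulmx trmx_mul trmxK mulmxA mul_rV_lin1. Qed.

End Euclidean.

Section Nonsmooth.
Context {R : realType}.

Definition weakly_convex m (rho : R) (g : 'rV[R]_m -> R) : Prop :=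
  convex_function setT (fun y : 'rV[R]_m => g y + rho / 2 * norm2 y ^+ 2).

(* Clarke's generalized directional derivative: the limsup of
   (g (z + t v) - g z) / t as z --> y and t --> 0 from above. *)
Definition clarke_derivative m (g : 'rV[R]_m -> R) (y v : 'rV[R]_m) : \bar R :=
  limf_esup (fun p : 'rV[R]_m * R => ((g (p.1 + p.2 *: v) - g p.1) / p.2)%:E)
            (filter_prod (nbhs y) 0^'+).

Definition clarke_subdifferential m (g : 'rV[R]_m -> R) (y : 'rV[R]_m) :
    set 'rV[R]_m :=
  [set xi | forall v, ((dot xi v)%:E <= clarke_derivative g y v)%E].

(* Empty when x is not in C, as usual in convex analysis. *)
Definition normal_cone n (C : set 'rV[R]_n) (x : 'rV[R]_n) : set 'rV[R]_n :=
  [set v | C x /\ forall s, C s -> dot v (s - x) <= 0].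

(* For g rho-weakly convex and 0 < beta < 1 / rho the infimum is a minimum. *)
Definition moreau m (g : 'rV[R]_m -> R) (beta : R) (y : 'rV[R]_m) : R :=
  inf (range (fun u : 'rV[R]_m => g u + (2 * beta)^-1 * norm2 (u - y) ^+ 2)).

(* max_(s in C) <d, x - s>; for C nonempty and compact the supremum is a
   maximum. *)
Definition linear_gap n (C : set 'rV[R]_n) (d x : 'rV[R]_n) : R :=
  sup [set dot d (x - s) | s in C].

Definition gap n m (C : set 'rV[R]_n) (f : 'rV[R]_n -> R)
    (T : {linear 'rV[R]_n -> 'rV[R]_m}) (x : 'rV[R]_n) (xi : 'rV[R]_m) : R :=
  linear_gap C (grad f x + adjoint T xi) x.

Definition smoothed_gap n m (C : set 'rV[R]_n) (f : 'rV[R]_n -> R)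
    (T : {linear 'rV[R]_n -> 'rV[R]_m}) (g : 'rV[R]_m -> R) (beta : R)
    (x : 'rV[R]_n) : R :=
  linear_gap C (grad f x + adjoint T (grad (moreau g beta) (T x))) x.

End Nonsmooth.

(* Main.v *)
Require Import Defs.
From HB Require Import structures.
From mathcomp Require Import all_boot all_order all_algebra.
From mathcomp Require Import all_classical all_reals all_analysis.
From mathcomp Require Import ring lra.

(** Write p_j for the proximal point of T u_j with step alpha_j.  Minimality of
    p_j and weak convexity of g show that xi_j = (T u_j - p_j) / alpha_j satisfies
    g z >= g p_j + <xi_j, z - p_j> - rho/2 |z - p_j|^2 for all z.  This
    inequality squeezes the Moreau envelope between quadratics, so that xi_j is
    its gradient at T u_j.  Since g is Lipschitz the xi_j are bounded; along an
    ultrafilter they converge to some xi, and p_j = T u_j - alpha_j xi_j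
    converges to T ubar.  The quadratic inequality passes to the limit, where it
    implies that xi is a Clarke subgradient, and so do the inequalities
    <grad f (u_j) + T^* xi_j, u_j - s> <= gap_j for each fixed s in C. *)

Import Order.TTheory GRing.Theory Num.Theory.
Import numFieldNormedType.Exports.

Local Open Scope classical_set_scope.
Local Open Scope ring_scope.

(** * The Euclidean inner product: continuity, compact balls, recognising a gradient *)

Section DotProduct.
Context {R : realType}.

Lemma dotC {n} (x y : 'rV[R]_n) : dot x y = dot y x.
Proof. by apply: eq_bigr => i _; rewrite mulrC. Qed.

Lemma dotDl {n} (x y z : 'rV[R]_n) : dot (x + y) z = dot x z + dot y z.
Proof. by rewrite -big_split; apply: eq_bigr => i _; rewrite mxE mulrDl. Qed.

Lemma dotZl {n} (a : R) (x y : 'rV[R]_n) : dot (a *: x) y = a * dot x y.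
Proof. by rewrite mulr_sumr; apply: eq_bigr => i _; rewrite mxE mulrA. Qed.

Lemma dotNl {n} (x y : 'rV[R]_n) : dot (- x) y = - dot x y.
Proof. by rewrite -scaleN1r dotZl mulN1r. Qed.

Lemma dotDr {n} (x y z : 'rV[R]_n) : dot x (y + z) = dot x y + dot x z.
Proof. by rewrite ![dot x _]dotC dotDl. Qed.

Lemma dotZr {n} (a : R) (x y : 'rV[R]_n) : dot x (a *: y) = a * dot x y.
Proof. by rewrite ![dot x _]dotC dotZl. Qed.

Lemma dotNr {n} (x y : 'rV[R]_n) : dot x (- y) = - dot x y.
Proof. by rewrite ![dot x _]dotC dotNl. Qed.

Definition dotE {n} :=
  (@dotDl n, @dotDr n, @dotNl n, @dotNr n, @dotZl n, @dotZr n).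

Lemma dot_ge0 {n} (x : 'rV[R]_n) : 0 <= dot x x.
Proof. by apply: sumr_ge0 => i _; rewrite -expr2 sqr_ge0. Qed.

Lemma norm2_sqr {n} (x : 'rV[R]_n) : norm2 x ^+ 2 = dot x x.
Proof. by rewrite sqr_sqrtr // dot_ge0. Qed.

Lemma coord_sqr_le_dot {n} (x : 'rV[R]_n) i : x ord0 i ^+ 2 <= dot x x.
Proof.
rewrite expr2 /dot (bigD1 i) //= lerDl.
by apply: sumr_ge0 => j _; rewrite -expr2 sqr_ge0.
Qed.

Lemma dot_le_normr {n} (x : 'rV[R]_n) : dot x x <= n%:R * `|x| ^+ 2.
Proof.
have -> : n%:R * `|x| ^+ 2 = \sum_(i < n) `|x| ^+ 2.
  by rewrite sumr_const card_ord mulr_natl.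
apply: ler_sum => i _; rewrite -expr2 -real_normK ?num_real //.
rewrite lerXn2r ?nnegrE //.
rewrite [leRHS]/Num.norm /= mx_normrE.
by apply/bigmax_geP; right; exists (ord0, i).
Qed.

Lemma dot_delta {n} (x : 'rV[R]_n) i : dot x (delta_mx ord0 i) = x ord0 i.
Proof.
rewrite /dot (bigD1 i) //= big1 => [|j ji]; rewrite mxE eqxx ?eqxx ?mulr1 ?addr0 //.
by rewrite (negbTE ji) mulr0.
Qed.

Lemma cvg_dot {I : Type} {F : set_system I} {FF : Filter F} {n}
    (x y : I -> 'rV[R]_n) (a b : 'rV[R]_n) :
  x @ F --> a -> y @ F --> b -> dot (x i) (y i) @[i --> F] --> dot a b.
Proof.
move=> xa yb; apply: cvg_big => [|i _]; first exact: add_continuous.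
apply: cvgM.
  exact: (cvg_comp _ _ xa (@coord_continuous R 1 n ord0 i a)).
exact: (cvg_comp _ _ yb (@coord_continuous R 1 n ord0 i b)).
Qed.

Lemma cvg_norm2 {I : Type} {F : set_system I} {FF : Filter F} {n}
    (x : I -> 'rV[R]_n) (a : 'rV[R]_n) :
  x @ F --> a -> norm2 (x i) @[i --> F] --> norm2 a.
Proof.
move=> xa; rewrite /norm2; apply: continuous_cvg; first exact: sqrt_continuous.
exact: cvg_dot.
Qed.

Lemma norm2_0 n : norm2 (0 : 'rV[R]_n) = 0.
Proof. by rewrite /norm2 -(scale0r 0) dotZl mul0r sqrtr0. Qed.

Lemma dotNN {n} (x : 'rV[R]_n) : dot (- x) (- x) = dot x x.
Proof. by rewrite !dotE opprK. Qed.

Lemma norm2_distC {n} (x y : 'rV[R]_n) : norm2 (x - y) = norm2 (y - x).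
Proof. by rewrite /norm2 -opprB dotNN. Qed.

Lemma norm2Z {n} (a : R) (x : 'rV[R]_n) : norm2 (a *: x) = `|a| * norm2 x.
Proof.
by rewrite /norm2 dotZl dotZr mulrA -expr2 sqrtrM ?sqr_ge0 // sqrtr_sqr.
Qed.

Lemma linear_rV_continuous {n m} (T : {linear 'rV[R]_n -> 'rV[R]_m}) : continuous T.
Proof.
have -> : (T : _ -> _) = fun x => \sum_i x ord0 i *: T (delta_mx ord0 i).
  apply/funext => x; rewrite {1}(row_sum_delta x) linear_sum.
  by apply: eq_bigr => i _; rewrite linearZ.
apply: continuous_big => [|i _ x]; first exact: add_continuous.
by apply: cvgZr_tmp; [exact: (nbhs_filter x)|exact: coord_continuous].
Qed.

Lemma cvg_dot_shift {I : Type} {F : set_system I} {FF : Filter F} {n}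
    (y : 'rV[R]_n) (x : I -> 'rV[R]_n) (a : 'rV[R]_n) :
  x @ F --> a -> dot (x i - y) (x i - y) @[i --> F] --> dot (a - y) (a - y).
Proof. by move=> xa; apply: cvg_dot; apply: cvgB => //; exact: cvg_cst. Qed.

Lemma dot_shift_continuous {n} (y : 'rV[R]_n) :
  continuous (fun x : 'rV[R]_n => dot (x - y) (x - y)).
Proof.
move=> x; rewrite /continuous_at; exact: (cvg_dot_shift _ _ _ (@cvg_id _ (nbhs x))).
Qed.

Lemma compact_dot_ball {n} (y : 'rV[R]_n) (r : R) :
  compact [set x | dot (x - y) (x - y) <= r].
Proof.
apply: bounded_closed_compact.
  (* A coordinate [t] of [x - y] has [t ^+ 2 <= r], hence absolute value at most [r + 1]; this
     bounds the sup norm without a square root. *)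
  exists (`|r| + 1 + `|y|); split; first exact: num_real.
  move=> M rM x /= xr; apply: le_trans (ltW rM).
  rewrite -{1}(subrK y x); apply: (le_trans (ler_normD _ _)); rewrite lerD2r.
  rewrite [leLHS]/Num.norm /= mx_normrE; apply/bigmax_leP; split=> [|[k i] _ /=].
    by rewrite addr_ge0.
  rewrite ord1; have := le_trans (coord_sqr_le_dot _ i) xr.
  move: ((x - y) ord0 i) => t tr.
  have r0 : 0 <= r by exact: le_trans (sqr_ge0 _) tr.
  rewrite (ger0_norm r0) ler_norml; apply/andP; split; nra.
by apply: closed_comp (@closed_le R r) => x _; exact: dot_shift_continuous.
Qed.

(** A quadratic remainder is o(h), so uniqueness of the differential forces ['d e y] to be
    [dot a]. *)
Lemma grad_of_quadratic_bound {n} (e : 'rV[R]_n -> R) (y a : 'rV[R]_n) (K : R)  :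
  0 <= K -> (forall h, `|e (y + h) - e y - dot a h| <= K * dot h h) -> grad e y = a.
Proof.
move=> K0 eK.
have dlin : linear (dot a : 'rV[R]_n -> R).
  by move=> c x z; rewrite dotDr dotZr.
pose d := HB.pack_for {linear 'rV[R]_n -> R} (dot a)
  (GRing.isLinear.Build R 'rV[R]_n R _ (dot a) dlin).
have dcont : continuous d.
  by move=> x; exact: (cvg_dot (fun=> a) id _ _ (cvg_cst a) (@cvg_id _ (nbhs x))).
have : 'd e y = d :> ('rV[R]_n -> R).
  apply: diff_unique => //; apply/eqaddoP => eps eps0 /=.
  (* In the sup norm the remainder is at most [K * n%:R * |h|^2]; the radius [eps / (K * n%:R + 1)]
     makes this at most [eps * |h|], and the [+ 1] covers [K * n%:R = 0]. *)
  have Kn0 : 0 < K * n%:R + 1 by rewrite ltr_wpDl // mulr_ge0.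
  have d0 : 0 < (K * n%:R + 1)^-1 * eps by rewrite mulr_gt0 ?invr_gt0.
  apply: filterS (@nbhs0_le R 'rV[R]_n _ d0) => h hle.
  have -> : (e \o shift y - (cst (e y) + d)) h = e (y + h) - e y - dot a h.
    by rewrite !fctE /= opprD addrA [h + y]addrC.
  apply: (le_trans (eK h)).
  apply: (@le_trans _ _ (K * (n%:R * `|h| ^+ 2))).
    by rewrite ler_wpM2l // dot_le_normr.
  rewrite expr2 !mulrA ler_wpM2r //.
  apply: (@le_trans _ _ ((K * n%:R + 1) * `|h|)).
    by rewrite ler_wpM2r // lerDl.
  by rewrite -ler_pdivlMl.
move=> dE; apply/rowP => i; rewrite mxE dE /=; exact: dot_delta.
Qed.

End DotProduct.

(** * Proximal points and the Moreau envelope of a weakly convex function *)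

Section WeaklyConvex.
Context {R : realType} {m : nat}.
Variables (g : 'rV[R]_m -> R) (rho : R).
Hypothesis g_wc : weakly_convex rho g.

(** Equivalently, [xi + rho *: y] is a convex subgradient of g + rho/2 |.|^2 at [y]. *)
Definition weak_subgradient (y xi : 'rV[R]_m) : Prop :=
  forall z, g y + dot xi (z - y) - rho / 2 * dot (z - y) (z - y) <= g z.

(** Convexity of g + rho/2 |.|^2, combined with t|p+d|^2 + (1-t)|p|^2 - |p+td|^2 = t(1-t)|d|^2. *)
Lemma weakly_convex_segment (t : R) (p d : 'rV[R]_m) : 0 <= t <= 1 ->
  g (p + t *: d) <=
  (1 - t) * g p + t * g (p + d) + rho / 2 * (t * (1 - t)) * dot d d.
Proof.
move=> t01.
pose t' := Itv01 (andP t01).1 (andP t01).2.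
have H := g_wc t' (p + d) p (mem_set I) (mem_set I).
rewrite /conv /= /conv /= !norm2_sqr /unstable.onem in H.
have E : t *: (p + d) + (1 - t) *: p = p + t *: d.
  by rewrite scalerDr scalerBl scale1r addrC addrA subrK.
rewrite E /GRing.scale /= in H.
move: H; rewrite !dotE (dotC d p).
lra.
Qed.

Lemma ge0_of_affine_ge0 (Q E : R) :
  (forall t, 0 < t <= 1 -> 0 <= Q + t * E) -> 0 <= Q.
Proof.
move=> QE; rewrite leNgt; apply/negP => Q0.
have den0 : 0 < 2 * (`|E| - Q) by have := normr_ge0 E; lra.
(* If [Q < 0], this [t] satisfies t|E| <= -Q/2, so Q + tE <= Q/2 < 0. *)
set t := - Q / (2 * (`|E| - Q)).
have tE : t * (2 * (`|E| - Q)) = - Q by rewrite divfK // gt_eqF.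
have t0 : 0 < t by rewrite divr_gt0 // oppr_gt0.
have t1 : t <= 1 by rewrite ler_pdivrMr //; have := normr_ge0 E; lra.
have := QE t; rewrite t0 t1 => /(_ isT).
have : t * E <= t * `|E| by rewrite ler_pM2l // ler_norm.
have : 0 <= t * - Q by rewrite mulr_ge0 // ltW // oppr_gt0.
lra.
Qed.

Definition is_prox (beta : R) (y p : 'rV[R]_m) : Prop :=
  forall z, g p + (2 * beta)^-1 * dot (p - y) (p - y) <=
            g z + (2 * beta)^-1 * dot (z - y) (z - y).

(** Compare [p] with p + t(z - p), bound g there by weak convexity, divide by t and let t tend to
    0. *)
Lemma prox_weak_subgradient (beta : R) (y p : 'rV[R]_m) : 0 < beta ->
  is_prox beta y p -> weak_subgradient p (beta^-1 *: (y - p)).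
Proof.
move=> b0 py z; rewrite -subr_ge0.
set d := z - p; have -> : z = p + d by rewrite addrC subrK.
(* After division by t the terms still carrying t are t|d|^2/(2 beta) from the proximal quadratic
   and -t rho/2 |d|^2 from the factor 1 - t. *)
apply: (@ge0_of_affine_ge0 _ (((2 * beta)^-1 - rho / 2) * dot d d)).
move=> t /andP[t0 t1]; rewrite -(pmulr_rge0 _ t0).
have t01 : 0 <= t <= 1 by rewrite ltW.
have := weakly_convex_segment t p d t01; have := py (p + t *: d).
have -> : p + t *: d - y = (p - y) + t *: d by rewrite addrAC.
rewrite invfM.
have -> : y - p = - (p - y) by rewrite opprB.
move: (p - y) => w; clearbody d; rewrite !dotE (dotC d w).
move: (beta^-1) => b; lra.
Qed.

Variable Lg : R.
Hypothesis g_lip : forall y z, `|g y - g z| <= Lg * norm2 (y - z).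

Lemma cvg_lipschitz {I : Type} {F : set_system I} {FF : Filter F}
    (x : I -> 'rV[R]_m) (a : 'rV[R]_m) :
  x @ F --> a -> g (x i) @[i --> F] --> g a.
Proof.
move=> xa; apply/cvgrPdist_le => e e0.
have : Lg * norm2 (a - x i) @[i --> F] --> Lg * norm2 (a - a).
  by apply: cvgM; [exact: cvg_cst|apply: cvg_norm2; apply: cvgB => //; exact: cvg_cst].
rewrite subrr norm2_0 mulr0 => /cvgrPdist_le/(_ e e0).
apply: filterS => i; rewrite sub0r normrN; apply: le_trans.
exact: le_trans (g_lip a (x i)) (ler_norm _).
Qed.

Lemma exists_prox (beta : R) (y : 'rV[R]_m) : 0 < beta ->
  exists p, is_prox beta y p.
Proof.
move=> b0.
(* Squared radius beyond which |z - y|^2/(2 beta) outweighs the largest decrease Lg |z - y| of g;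
   outside this ball F z >= F y, so a minimizer over the ball is global. *)
pose r := (2 * beta * Lg) ^+ 2.
pose F z := g z + (2 * beta)^-1 * dot (z - y) (z - y).
have Fcont : continuous F.
  move=> z; have Gz := @cvg_id _ (nbhs z).
  exact: (cvgD (cvg_lipschitz id z Gz)
               (cvgM (cvg_cst (2 * beta)^-1) (cvg_dot_shift y id z Gz))).
have [||p] := @EVT_min_rV R m F _ _ (compact_dot_ball y r).
- by exists y; rewrite /= subrr -(scale0r 0) dotZl mul0r sqr_ge0.
- by move=> z; apply: continuous_subspaceT.
rewrite inE /= => pr Fp.
have yin : F p <= F y.
  by apply: Fp; rewrite inE /= subrr -(scale0r 0) dotZl mul0r sqr_ge0.
exists p => z; rewrite -/(F p) -/(F z).
have [zr|zr] := leP (dot (z - y) (z - y)) r; first by apply: Fp; rewrite inE.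
apply: (le_trans yin); rewrite /F subrr -{1 2}(scale0r 0) dotZl mul0r mulr0 addr0.
have gyz := le_trans (ler_norm _) (g_lip y z).
rewrite -norm2_sqr in zr *; rewrite norm2_distC in gyz.
have N0 : 0 <= norm2 (z - y) by exact: sqrtr_ge0.
move: (norm2 (z - y)) zr gyz N0 => N zr gyz N0.
have b2 : 0 < 2 * beta by lra.
have LgN : Lg <= (2 * beta)^-1 * N.
  rewrite ler_pdivlMl // leNgt; apply/negP; move: zr; rewrite /r.
  move: (2 * beta * Lg) => B; nra.
nra.
Qed.

(** Testing minimality of [p] against [y] gives |y - p|^2/(2 beta) <= g y - g p <= Lg |y - p|;
    divide by |y - p| unless it vanishes. The bound does not depend on [beta], which gives
    compactness as the step tends to 0. *)
Lemma norm2_prox_residual_le (beta : R) (y p : 'rV[R]_m) : 0 < beta -> is_prox beta y p ->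
  norm2 (beta^-1 *: (y - p)) <= 2 * `|Lg|.
Proof.
move=> b0 /(_ y); rewrite subrr -{1 2}(scale0r 0) dotZl mul0r mulr0 addr0 => py.
have := le_trans (ler_norm _) (g_lip y p).
rewrite norm2Z ger0_norm ?invr_ge0 ?(ltW b0) //.
move: py; rewrite -opprB dotNN -norm2_sqr => py gL.
have N0 : 0 <= norm2 (y - p) by exact: sqrtr_ge0.
have : (2 * beta)^-1 * norm2 (y - p) ^+ 2 <= Lg * norm2 (y - p) by lra.
rewrite invfM expr2; move: N0; rewrite le_eqVlt => /predU1P[<-|N0].
  by rewrite !mulr0 => _; rewrite mulr_ge0.
rewrite mulrA ler_pM2r // => H; have := ler_norm Lg; lra.
Qed.

Lemma moreauE (beta : R) (y p : 'rV[R]_m) : is_prox beta y p ->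
  moreau g beta y = g p + (2 * beta)^-1 * dot (p - y) (p - y).
Proof.
move=> py; rewrite /moreau.
apply/eqP; rewrite eq_le; apply/andP; split.
  apply: ge_inf; last by exists p => //; rewrite norm2_sqr.
  exists (g p + (2 * beta)^-1 * dot (p - y) (p - y)) => _ [z _ <-].
  by rewrite norm2_sqr.
apply: lb_le_inf; first by exists (g p + (2 * beta)^-1 * norm2 (p - y) ^+ 2), p.
by move=> _ [z _ <-]; rewrite norm2_sqr.
Qed.

(** Upper bound at [y + h]: use [p] as a competitor. Lower bound: apply the weak subgradient
    inequality at [p] to the proximal point [q] of [y + h], which leaves a quadratic in [q - p] with
    leading coefficient c/2. *)
Lemma grad_moreau (beta : R) (y p : 'rV[R]_m) : 0 < beta -> rho * beta < 1 ->
  is_prox beta y p -> grad (moreau g beta) y = beta^-1 *: (y - p).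
Proof.
move=> b0 rb py; set xi := _ *: _.
have yE : y = p + beta *: xi by rewrite scalerA divff ?gt_eqF // scale1r addrC subrK.
pose c := beta^-1 - rho.
have c0 : 0 < c by rewrite subr_gt0 -ltr_pdivlMr // ?div1r in rb *.
(* The first summand is the error of the upper bound; the second is the cost of completing the
   square in c/2 |w|^2 - <w,h>/beta, with w = q - p. *)
pose K := (2 * beta)^-1 + beta^-1 ^+ 2 / (2 * c).
have bi0 : 0 < beta^-1 by rewrite invr_gt0.
apply: (@grad_of_quadratic_bound _ _ _ _ _ K) => [|h].
  by rewrite addr_ge0 // ?mulr_ge0 ?exprn_ge0 ?invr_ge0; lra.
have [q qy] := exists_prox beta (y + h) b0.
have sub := prox_weak_subgradient _ _ _ b0 py q.
rewrite (moreauE _ _ _ py) (moreauE _ _ _ qy).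
have qp := qy p; rewrite -/xi in sub; clearbody xi; clear qy py; subst y.
move: sub qp; have [w ->] : exists w, q = p + w by exists (q - p); rewrite addrC subrK.
have pE (v : 'rV[R]_m) : p + v - p = v by rewrite addrC addKr.
have E1 (v : 'rV[R]_m) : p + v - (p + beta *: xi + h) = v - (beta *: xi + h).
  by rewrite -[p + _ + h]addrA opprD addrACA subrr add0r.
have E2 : p - (p + beta *: xi + h) = - (beta *: xi + h).
  by rewrite -[p + _ + h]addrA opprD addrA subrr add0r.
have E3 : p - (p + beta *: xi) = - (beta *: xi) by rewrite opprD addrA subrr add0r.
move=> sub qp.
have sq : 0 <= dot (c *: w - beta^-1 *: h) (c *: w - beta^-1 *: h) by exact: dot_ge0.
move: sub qp sq; rewrite pE E1 E2 E3 !dotE (dotC h w) (dotC xi w) (dotC xi h).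
have := dot_ge0 h; rewrite /K.
move: (dot h h) (dot w w) (dot w h) (dot w xi) (dot xi xi) (dot h xi).
move=> hh ww wh wx xx hx hh0.
move: (g (p + w)) (g p) => gq gp sub qp sq.
have bE : (2 * beta)^-1 = beta^-1 / 2 by rewrite invfM mulrC.
have b0' : beta != 0 by rewrite gt_eqF.
have c0' : c != 0 by rewrite gt_eqF.
have {}sq : 0 <= c / 2 * ww - beta^-1 * wh + beta^-1 ^+ 2 / (2 * c) * hh.
  rewrite -(pmulr_rge0 _ (_ : 0 < 2 * c)); last by lra.
  apply: le_trans sq _; rewrite le_eqVlt; apply/orP; left; apply/eqP; field.
  by rewrite b0' c0'.
have K2 : 0 <= beta^-1 ^+ 2 / (2 * c) * hh.
  by rewrite mulr_ge0 // divr_ge0 ?sqr_ge0 //; lra.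
have bh : 0 <= beta^-1 * hh by rewrite mulr_ge0 // ltW.
have M1 : (2 * beta)^-1 *
  (ww - (beta * wx + wh) + (- (beta * wx + wh) -
     (- (beta * (beta * xx) + beta * hx) - (beta * hx + hh)))) =
  beta^-1 / 2 * ww - wx - beta^-1 * wh + beta / 2 * xx + hx + beta^-1 / 2 * hh.
  by field.
have M2 : (2 * beta)^-1 * - (- (beta * (beta * xx) + beta * hx) - (beta * hx + hh)) =
  beta / 2 * xx + hx + beta^-1 / 2 * hh by field.
have M3 : (2 * beta)^-1 * - - (beta * (beta * xx)) = beta / 2 * xx by field.
rewrite M1 M2 in qp; rewrite M1 M3 bE {M1 M2 M3}; move: sub; rewrite /c in sq K2 *.
move: (_ / (2 * _)) sq K2 => k; rewrite ler_norml; lra.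
Qed.

End WeaklyConvex.

(** * Limits of subgradients, convergence along ultrafilters, and linear gaps *)

Section Limits.
Context {R : realType}.

(** Base points equal to [y] suffice to bound the limsup from below: there the difference quotient
    is at least <xi,v> - rho/2 t|v|^2, and the last term vanishes with t. *)
Lemma weak_subgradient_clarke {m} (g : 'rV[R]_m -> R) (rho : R) y xi :
  weak_subgradient g rho y xi -> clarke_subdifferential g y xi.
Proof.
move=> sub v; rewrite /clarke_derivative limf_esupE.
apply: le_ereal_inf_tmp => _ [V [[P Q] [/= Py Q0] PQV] <-].
apply/lee_subgt0Pr => e e0; rewrite -EFinB.
have rv : rho / 2 * t * dot v v @[t --> 0^'+] --> rho / 2 * 0 * dot v v.
  apply: cvgM; last exact: cvg_cst.
  by apply: cvgM; [exact: cvg_cst|exact: cvg_at_right_filter].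
rewrite mulr0 mul0r in rv; move/cvgrPdist_le : rv => /(_ e e0) small.
have [t [[Qt t0] te]] := filter_ex (filterI (filterI Q0 (nbhs_right_gt 0)) small).
apply: le_ereal_sup_tmp; exists ((g (y + t *: v) - g y) / t)%:E.
  exists (y, t) => //; apply: PQV; split => //; exact: nbhs_singleton.
rewrite lee_fin ler_pdivlMr //.
have yt : y + t *: v - y = t *: v by rewrite addrC addKr.
have := sub (y + t *: v); rewrite yt dotZr dotZl dotZr.
move: te; rewrite sub0r normrN => /(le_trans (ler_norm _)) te.
have : t * (rho / 2 * t * dot v v) <= t * e by rewrite ler_pM2l.
lra.
Qed.

Lemma weak_subgradient_lim {m} (g : 'rV[R]_m -> R) (rho : R)
    {I : Type} {F : set_system I} {FF : ProperFilter F}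
    (y xi : I -> 'rV[R]_m) (y0 xi0 : 'rV[R]_m) :
  g (y i) @[i --> F] --> g y0 -> y @ F --> y0 -> xi @ F --> xi0 ->
  (forall i, weak_subgradient g rho (y i) (xi i)) -> weak_subgradient g rho y0 xi0.
Proof.
move=> gy yy0 xx0 sub z.
have zy : z - y i @[i --> F] --> z - y0 by apply: cvgB => //; exact: cvg_cst.
have lim : g (y i) + dot (xi i) (z - y i) - rho / 2 * dot (z - y i) (z - y i)
    @[i --> F] --> g y0 + dot xi0 (z - y0) - rho / 2 * dot (z - y0) (z - y0).
  apply: cvgB; first by apply: cvgD => //; exact: cvg_dot.
  by apply: cvgM; [exact: cvg_cst|exact: cvg_dot].
by apply: (cvgr_to_le lim); apply: nearW => i; exact: sub.
Qed.

(** A cluster point is a limit here: the ultrafilter contains the preimage of a neighbourhood [V] or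
    of its complement, and the latter would contradict clustering. *)
Lemma compact_ultra_cvg {T : topologicalType} {I : Type} (G : set_system I)
    (x : I -> T) (A : set T) :
  UltraFilter G -> compact A -> (forall i, A (x i)) -> exists a : T, x @ G --> a.
Proof.
move=> UG cA Ax.
have PG : ProperFilter (x @ G) by exact: fmap_proper_filter.
have [|a [_ clu]] := cA (x @ G) PG; first exact: (@filterE _ G _ (x @^-1` A)) Ax.
exists a => V Va.
have [//|nV] := in_ultra_setVsetC (x @^-1` V) UG.
by have [t []] := clu (~` V) V nV Va.
Qed.

Lemma linear_gap_ge {n} (C : set 'rV[R]_n) (d x s : 'rV[R]_n) :
  compact C -> C s -> dot d (x - s) <= linear_gap C d x.
Proof.
move=> cC Cs; apply: ub_le_sup; last by exists s.
(* [sup] is an upper bound only of a set that is bounded above; the maximum over compact [C]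
   provides this. *)
have cont : {within C, continuous (fun s => dot d (x - s))}.
  apply: continuous_subspaceT => z.
  exact: (cvg_dot (fun=> d) _ _ _ (cvg_cst d) (cvgB (cvg_cst x) (@cvg_id _ (nbhs z)))).
have [|t _ tmax] := @EVT_max_rV R n (fun s => dot d (x - s)) C _ cC cont.
  by exists s.
by exists (dot d (x - t)) => _ [z Cz <-]; apply: tmax; rewrite inE.
Qed.

(** The choice s = x attains the value 0. *)
Lemma linear_gap_eq0 {n} (C : set 'rV[R]_n) (d x : 'rV[R]_n) :
  C x -> (forall s, C s -> dot d (x - s) <= 0) -> linear_gap C d x = 0.
Proof.
move=> Cx neg; apply/eqP; rewrite eq_le; apply/andP; split.
  by apply: ge_sup => [|_ [s Cs <-]]; [exists (dot d (x - x)), x|exact: neg].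
apply: ub_le_sup; first by exists 0 => _ [s Cs <-]; exact: neg.
by exists x => //; rewrite subrr -(scale0r 0) dotZr mul0r.
Qed.

End Limits.

(** * Stationarity of the limit point, by passage to the limit along an ultrafilter *)

Theorem theorem5p8 (R : realType) (n m : nat)
    (C : set 'rV[R]_n) (f : 'rV[R]_n -> R)
    (T : {linear 'rV[R]_n -> 'rV[R]_m})
    (g : 'rV[R]_m -> R) (Lg rho : R)
    (u : nat -> 'rV[R]_n) (alpha : nat -> R) (ubar : 'rV[R]_n)
    (C_nonempty : C !=set0) (C_compact : compact C) (C_convex : convex_set C)
    (f_C1 : exists U : set 'rV[R]_n, [/\ open U, C `<=` U &
      forall x, U x -> differentiable f x /\ {for x, continuous (grad f)}])
    (grad_f_lipschitz : exists Lf : R, forall x y, C x -> C y ->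
      norm2 (grad f x - grad f y) <= Lf * norm2 (x - y))
    (g_lipschitz : forall y z, `|g y - g z| <= Lg * norm2 (y - z))
    (rho_ge0 : 0 <= rho) (g_weakly_convex : weakly_convex rho g)
    (u_in_C : forall j, C (u j))
    (alpha_range : forall j, 0 < alpha j /\ ((alpha j)%:E < (rho%:E)^-1)%E)
    (alpha_cvg : alpha j @[j --> \oo] --> 0)
    (u_cvg : u j @[j --> \oo] --> ubar)
    (gap_cvg : smoothed_gap C f T g (alpha j) (u j) @[j --> \oo] --> 0) :
  (exists xi : 'rV[R]_m,
     [/\ clarke_subdifferential g (T ubar) xi,
         gap C f T ubar xi = 0 &
         [set grad f ubar + adjoint T xi + v | v in normal_cone C ubar] 0])
  /\ [set grad f ubar + w + v | w in adjoint T @` clarke_subdifferential g (T ubar)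
                              & v in normal_cone C ubar] 0.
Proof.
(* For [rho = 0] the extended inverse is +oo and the product is 0; otherwise multiply the bound on
   [alpha j] by [rho]. *)
have ra j : rho * alpha j < 1.
  have [a0] := alpha_range j; have [->|rho0] := eqVneq rho 0; first by rewrite mul0r.
  have rho_gt0 : 0 < rho by rewrite lt_neqAle eq_sym rho0.
  by rewrite inver (negbTE rho0) lte_fin -(ltr_pM2l rho_gt0) divff.
have Cub : C ubar.
  apply: (closed_cvg _ (compact_closed (@norm_hausdorff _ _) C_compact) _ _ u_cvg).
  exact: nearW.
have /choice[p p_prox] j : exists q, is_prox g (alpha j) (T (u j)) q.
  exact: (@exists_prox _ _ g _ g_lipschitz _ _ (alpha_range j).1).
pose xi j := (alpha j)^-1 *: (T (u j) - p j).
have xi_ball j : dot (xi j - 0) (xi j - 0) <= (2 * `|Lg|) ^+ 2.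
  rewrite subr0 -norm2_sqr lerXn2r ?nnegrE ?sqrtr_ge0 ?mulr_ge0 //.
  exact: (norm2_prox_residual_le _ _ g_lipschitz _ _ _ (alpha_range j).1).
(* An ultrafilter finer than [\oo] replaces the extraction of a subsequence; every limit along [\oo]
   persists along it. *)
have [G [UG ooG]] := @ultraFilterLemma nat \oo _.
have [xi0 xi_cvg] := compact_ultra_cvg G xi _ UG (compact_dot_ball 0 _) xi_ball.
have aG : alpha @ G --> 0 by exact: cvg_trans (cvg_app _ ooG) alpha_cvg.
have uG : u @ G --> ubar by exact: cvg_trans (cvg_app _ ooG) u_cvg.
have gapG : smoothed_gap C f T g (alpha j) (u j) @[j --> G] --> 0.
  exact: cvg_trans (cvg_app _ ooG) gap_cvg.
have TuG : T (u j) @[j --> G] --> T ubar.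
  exact: (continuous_cvg _ (linear_rV_continuous T ubar) uG).
have pG : p @ G --> T ubar.
  have -> : p = fun j => T (u j) - alpha j *: xi j.
    apply/funext => j; rewrite scalerA divff ?gt_eqF ?(alpha_range j).1 //.
    by rewrite scale1r subKr.
  rewrite -[X in _ --> X]subr0 -(scale0r xi0).
  by apply: cvgB => //; exact: cvgZ.
have sub0 : weak_subgradient g rho (T ubar) xi0.
  apply: (weak_subgradient_lim _ _ _ _ _ _ (cvg_lipschitz _ _ g_lipschitz _ _ pG) pG xi_cvg).
  by move=> j; apply: prox_weak_subgradient => //; exact: (alpha_range j).1.
have gradG : grad f (u j) @[j --> G] --> grad f ubar.
  have [U [_ CU fU]] := f_C1.
  exact: (continuous_cvg _ (fU _ (CU _ Cub)).2 uG).
have neg s : C s -> dot (grad f ubar + adjoint T xi0) (ubar - s) <= 0.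
  (* Moving the adjoint across leaves inner products of the convergent families [T (u j)] and
     [xi j]. *)
  move=> Cs; rewrite dotDl [dot (adjoint _ _) _]dotC -dot_adjoint linearB.
  have lim : dot (grad f (u j)) (u j - s) + dot (T (u j) - T s) (xi j)
      @[j --> G] --> dot (grad f ubar) (ubar - s) + dot (T ubar - T s) xi0.
    by apply: cvgD; apply: cvg_dot => //; apply: cvgB => //; exact: cvg_cst.
  apply: (ler_cvg_to lim gapG); apply: nearW => j.
  apply: le_trans (linear_gap_ge _ _ _ _ C_compact Cs).
  rewrite (grad_moreau _ _ g_weakly_convex _ g_lipschitz _ _ _ (alpha_range j).1 (ra j) (p_prox j)).
  by rewrite dotDl [dot (adjoint _ _) _]dotC -dot_adjoint linearB.
(* Nonpositivity of all <d, ubar - s> says exactly that -d is normal to [C] at [ubar]; this -d is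
   the witness in both inclusions. *)
have cone : normal_cone C ubar (- (grad f ubar + adjoint T xi0)).
  by split=> // s Cs; rewrite dotNl -dotNr opprB; exact: neg.
have clarke := weak_subgradient_clarke _ _ _ _ sub0.
split.
  exists xi0; split=> //; first exact: linear_gap_eq0.
  by exists (- (grad f ubar + adjoint T xi0)) => //; rewrite subrr.
exists (adjoint T xi0); first by exists xi0.
by exists (- (grad f ubar + adjoint T xi0)) => //; rewrite subrr.
Qed.
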